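(* Let $A$ be decomposed into a core $K_0$ and ends $U_1,\dots,U_m$ with exhaustions $h_i$ and admissible weights $\varphi_i$ as in the context, with all $\varphi_i$ unbounded, and let $W$ be the block weight. Let $f\in C(A)$ be such that $\inf_{c\in\mathbb{R}}\sup_A W|f-c|<\infty$. Then $f$ has the same limit at every end (i.e. there is $c\in\mathbb{R}$ with $\lim_{a\to\omega_i}f(a)=c$ for all $i$). Consequently, if $f\in C(A)$ satisfies $f\to L_i$ at $\omega_i$ for each $i$ with $L_1\ne L_2$, then $\inf_{c\in\mathbb{R}}\sup_A W|f-c|=+\infty$.
   Context: $A$ is a non-compact, locally compact, $\sigma$-compact Hausdorff space; $C(A)$ is the space of real continuous functions on $A$. Decomposition at infinity: there is a compact $K_0\subset A$ (the core) and finitely many pairwise disjoint, open, connected, non-compact sets $U_1,\dots,U_m$ (the ends) with $A\setminus K_0=\bigsqcup_{i=1}^m U_i$. Each $U_i$ carries a continuous $h_i:U_i\to[0,\infty)$ such that (E1) $\{x\in U_i:h_i(x)\le R\}$ is relatively compact in $A$ for every $R<\infty$; (E2) $h_i$ extends continuously to $\overline{U_i}$ with $h_i\equiv0$ on $\partial U_i\subset K_0$; (E3) $h_i$ is unbounded on $U_i$; (E4) $\partial U_i=\overline{U_i}\setminus U_i\neq\varnothing$. Each end carries an admissible weight $\varphi_i$. Admissible means: $\varphi:[0,\infty)\to[1,\infty)$ is continuous, non-decreasing, $\varphi(0)=1$, and there is $K\ge1$ with $\varphi(r+s)\le K\varphi(r)\varphi(s)$ for all $r,s\ge0$. Unbounded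 means $\varphi(t)\to\infty$ as $t\to\infty$. $\omega_i$ denotes the point at infinity of $U_i$: $a_k\to\omega_i$ means $a_k\in U_i$ eventually and $h_i(a_k)\to\infty$. The block weight $W:A\to[1,\infty)$ is $W\equiv1$ on $K_0$ and $W:=\varphi_i\circ h_i$ on $U_i$. *)

(* Defs.v *)
From HB Require Import structures.
From mathcomp Require Import all_boot all_order all_algebra.
From mathcomp Require Import mathcomp_extra boolp classical_sets functions.
From mathcomp Require Import interval_inference reals ereal topology normedtype.

Set Implicit Arguments.
Unset Strict Implicit.
Unset Printing Implicit Defensive.

Import Order.TTheory GRing.Theory Num.Theory.
Import numFieldTopology.Exports numFieldNormedType.Exports.

Local Open Scope classical_set_scope.
Local Open Scope ring_scope.

(* Functions with domain [0, +oo[ or U_i are represented by total functions on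
   R or A; every condition only constrains their values on the actual domain. *)

Definition sigma_compact (A : topologicalType) :=
  exists2 K : nat -> set A, (forall n, compact (K n)) & \bigcup_n K n = setT.

Record admissible (R : realType) (phi : R -> R) : Prop := Admissible {
  admissible_ge1 : forall r : R, 0 <= r -> 1 <= phi r ;
  admissible_continuous : {within `[0, +oo[, continuous phi} ;
  admissible_nondecreasing : forall r s : R, 0 <= r -> r <= s -> phi r <= phi s ;
  admissible0 : phi 0 = 1 ;
  admissible_submultiplicative : exists2 K : R, 1 <= K &
    forall r s : R, 0 <= r -> 0 <= s -> phi (r + s) <= K * phi r * phi s }.

Definition unbounded_weight (R : realType) (phi : R -> R) :=
  phi t @[t --> +oo] --> +oo.

(* The boundary of an open set; only used for the ends, which are open. *)
Definition frontier (A : topologicalType) (U : set A) := closure U `\` U.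

Record exhaustion (R : realType) (A : topologicalType) (K0 U : set A)
    (h : A -> R) : Prop := Exhaustion {
  exhaustion_ge0 : forall x, U x -> 0 <= h x ;
  exhaustion_continuous : {within U, continuous h} ;
  exhaustion_precompact : forall r : R, precompact [set x | U x /\ h x <= r] ;
  exhaustion_extends : exists g : A -> R,
    [/\ {within closure U, continuous g},
        forall x, U x -> g x = h x &
        forall x, frontier U x -> g x = 0] ;
  exhaustion_frontier_core : frontier U `<=` K0 ;
  exhaustion_unbounded : ~ has_ubound [set h x | x in U] ;
  exhaustion_frontier_neq0 : frontier U !=set0 }.

Record decomposition_at_infinity (R : realType) (A : topologicalType)
    (K0 : set A) (m : nat) (U : 'I_m -> set A) (h : 'I_m -> A -> R) : Prop :=
  DecompositionAtInfinity {
  core_compact : compact K0 ;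
  ends_disjoint : trivIset setT U ;
  ends_open : forall i, open (U i) ;
  ends_connected : forall i, connected (U i) ;
  ends_noncompact : forall i, ~ compact (U i) ;
  ends_cover : ~` K0 = \bigcup_i U i ;
  ends_exhaustion : forall i, exhaustion K0 (U i) (h i) }.

(* The ends are pairwise disjoint, so at most one index can be picked. *)
Definition block_weight (R : realType) (A : Type) (m : nat)
    (U : 'I_m -> set A) (h : 'I_m -> A -> R) (phi : 'I_m -> R -> R) (a : A) : R :=
  if [pick i | `[< U i a >]] is Some i then phi i (h i a) else 1.

Definition cvg_to_end (R : realType) (A : Type) (U : set A) (h : A -> R)
    (a : nat -> A) :=
  (\forall k \near \oo, U (a k)) /\ h (a k) @[k --> \oo] --> +oo.

Definition limit_at_end (R : realType) (A : Type) (U : set A) (h : A -> R)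
    (f : A -> R) (c : R) :=
  forall a : nat -> A, cvg_to_end U h a -> f (a k) @[k --> \oo] --> c.

Definition inf_weighted_sup (R : realType) (A : Type) (W f : A -> R) : \bar R :=
  ereal_inf [set ereal_sup [set (W a * `|f a - c|)%:E | a in [set: A]]
            | c in [set: R]].

Lemma block_weight_core (R : realType) (A : topologicalType) (K0 : set A)
    (m : nat) (U : 'I_m -> set A) (h : 'I_m -> A -> R) (phi : 'I_m -> R -> R)
    (a : A) :
  decomposition_at_infinity K0 U h -> K0 a -> block_weight U h phi a = 1.
Proof.
move=> D Ka; rewrite /block_weight; case: pickP => // i /asboolP Ui.
have : (~` K0) a by rewrite (ends_cover D); exists i.
by move=> /(_ Ka).
Qed.

Lemma block_weight_end (R : realType) (A : topologicalType) (K0 : set A)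
    (m : nat) (U : 'I_m -> set A) (h : 'I_m -> A -> R) (phi : 'I_m -> R -> R)
    (i : 'I_m) (a : A) :
  decomposition_at_infinity K0 U h -> U i a ->
  block_weight U h phi a = phi i (h i a).
Proof.
move=> D Ui; rewrite /block_weight; case: pickP => [j /asboolP Uj|/(_ i)].
  by rewrite (ends_disjoint D (i := i) (j := j)) //; exists a.
by move/asboolP.
Qed.

(* Main.v *)
(* A finite infimum yields one real [c] with [W |f - c|] bounded by some [B];
   on the end [U i] this reads [|f - c| <= B / phi i (h i)], which tends to [0].
   Unboundedness of [h i] provides sequences going to each end, so limits at the
   ends are unique and all equal to [c]. *)

Require Import Defs.
From HB Require Import structures.
From mathcomp Require Import all_boot all_order all_algebra.
From mathcomp Require Import mathcomp_extra boolp classical_sets functions.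
From mathcomp Require Import interval_inference reals ereal topology normedtype.

Set Implicit Arguments.
Unset Strict Implicit.
Unset Printing Implicit Defensive.

Import Order.TTheory GRing.Theory Num.Theory.
Import numFieldTopology.Exports numFieldNormedType.Exports.

Local Open Scope classical_set_scope.
Local Open Scope ring_scope.

(** An infimum below [+oo] need not be attained, but some member of the family lies below [+oo]; its
    index is [c], and the real value of its supremum is [B]. *)
Lemma inf_weighted_sup_lty (R : realType) (A : Type) (W f : A -> R) :
  (inf_weighted_sup W f < +oo)%E ->
  exists c B : R, forall a, W a * `|f a - c| <= B.
Proof.
move=> /ereal_inf_lt[_ [c _ <-]] sup_lty.
exists c, (fine (ereal_sup [set (W a * `|f a - c|)%:E | a in [set: A]])) => a.
have le_sup : ((W a * `|f a - c|)%:E <=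
    ereal_sup [set (W a * `|f a - c|)%:E | a in [set: A]])%E.
  by apply: ereal_sup_ubound; exists a.
(* [fine] preserves only finite values; the supremum exceeds [-oo] because it dominates the real
   term at [a]. *)
rewrite -lee_fin fineK // fin_real // sup_lty andbT.
exact: lt_le_trans (ltNyr _) le_sup.
Qed.

(** For each [k], a point of [U] with [h] at least [k] exists, since otherwise [k] would bound [h]
    on [U]; choosing one for every [k] gives the sequence. *)
Lemma exists_cvg_to_end (R : realType) (A : Type) (U : set A) (h : A -> R) :
  ~ has_ubound [set h x | x in U] -> exists a : nat -> A, cvg_to_end U h a.
Proof.
move=> h_unbounded.
have /choice[a aP] (k : nat) : exists x, U x /\ k%:R <= h x.
  apply: contrapT => noP; apply: h_unbounded; exists k%:R => _ [x Ux <-].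
  by rewrite leNgt; apply/negP => /ltW hx; apply: noP; exists x.
exists a; split; first by near=> k; have [] := aP k.
apply: (@ger_cvgy _ _ _ _ (fun k => k%:R)); last exact: cvgr_idn.
by near=> k; have [] := aP k.
Unshelve. all: by end_near. Qed.

(** Unboundedness of [h] rules out the vacuous case: if no sequence went to the end, every real
    would be a limit there. *)
Lemma limit_at_end_unique (R : realType) (A : Type) (U : set A) (h : A -> R)
    (f : A -> R) (c d : R) :
  ~ has_ubound [set h x | x in U] ->
  limit_at_end U h f c -> limit_at_end U h f d -> c = d.
Proof.
move=> /exists_cvg_to_end[a a_end] /(_ a a_end) fc /(_ a a_end) fd.
exact: cvg_unique fc fd.
Qed.

Lemma limit_at_end_weighted (R : realType) (A : Type) (U : set A) (h : A -> R)
    (phi : R -> R) (f : A -> R) (c B : R) :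
  unbounded_weight phi ->
  (forall a, U a -> phi (h a) * `|f a - c| <= B) ->
  limit_at_end U h f c.
Proof.
move=> phiy fB a [Ua hy].
have phihy : phi (h (a k)) @[k --> \oo] --> +oo by exact: cvg_comp hy phiy.
apply/cvgrPdist_lt => e e0; near=> k.
have Uak : U (a k) by near: k.
(* As [phi] is an arbitrary real function here, its positivity along the sequence is also read off
   from divergence. *)
have phi_gt0 : 0 < phi (h (a k)) by near: k; move/cvgryPgt: phihy; apply.
(* The threshold [B / e] makes [B] smaller than [phi (h (a k)) * e], which is the goal once both
   sides are multiplied by the weight. *)
have B_lt : B / e < phi (h (a k)) by near: k; move/cvgryPgt: phihy; apply.
rewrite distrC -(ltr_pM2l phi_gt0); apply: le_lt_trans (fB _ Uak) _.
by rewrite -ltr_pdivrMr.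
Unshelve. all: by end_near. Qed.

Theorem proposition8p2 (R : realType) (A : topologicalType)
    (A_noncompact : ~ compact [set: A])
    (A_locally_compact : locally_compact [set: A])
    (A_sigma_compact : sigma_compact A)
    (A_hausdorff : hausdorff_space A)
    (K0 : set A) (m : nat) (U : 'I_m -> set A) (h : 'I_m -> A -> R)
    (phi : 'I_m -> R -> R)
    (decomp : decomposition_at_infinity K0 U h)
    (phi_admissible : forall i, admissible (phi i))
    (phi_unbounded : forall i, unbounded_weight (phi i)) :
  (forall f : A -> R, continuous f ->
     (inf_weighted_sup (block_weight U h phi) f < +oo)%E ->
     exists c : R, forall i, limit_at_end (U i) (h i) f c) /\
  (forall f : A -> R, continuous f ->
     forall L : 'I_m -> R, (forall i, limit_at_end (U i) (h i) f (L i)) ->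
     forall i j : 'I_m, L i <> L j ->
     inf_weighted_sup (block_weight U h phi) f = +oo%E).
Proof.
have same_limit (f : A -> R) :
    (inf_weighted_sup (block_weight U h phi) f < +oo)%E ->
    exists c : R, forall i, limit_at_end (U i) (h i) f c.
  move=> /inf_weighted_sup_lty[c [B WB]]; exists c => i.
  apply: (limit_at_end_weighted (B := B) (phi_unbounded i)) => a Ua.
  by rewrite -(block_weight_end phi decomp Ua); exact: WB.
split=> [f _|f _ L fL i j Lij]; first exact: same_limit.
(* By contraposition: an infimum other than [+oo] is below it, so the first part gives a common
   limit [c], and uniqueness at each end identifies every [L k] with [c]. *)
apply/eqP; apply: contra_notT Lij; rewrite -ltey => /same_limit[c fc].
have limE k : L k = c.
  have h_unbounded := exhaustion_unbounded (ends_exhaustion decomp k).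
  exact: limit_at_end_unique h_unbounded (fL k) (fc k).
by rewrite !limE.
Qed.
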